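(* Let $\mathbb{K}\in\{\mathbb{R},\mathbb{C},\mathbb{H}\}$, let $\mathcal{O}\subset\mathbb{K}$ be the fixed order described in the context, and let $m\geq1$. The Thurston compactification $\overline{\mathcal{E}_m}^{\mathcal{T}}$ and the Satake compactification $\overline{\mathcal{E}_m}^{\mathcal{S}}$ of the symmetric space $\mathcal{E}_m=SL_m(\mathbb{K})/SU_m(\mathbb{K})$ are $SL_m(\mathbb{K})$-isomorphic, i.e. there is an $SL_m(\mathbb{K})$-equivariant homeomorphism between them which commutes with the embeddings of $\mathcal{E}_m$.
   Context: $\mathbb{H}$ is the skew field of Hamilton quaternions. $\mathbb{K}^m$ is a right $\mathbb{K}$-vector space, matrices act on the left, $\langle x,y\rangle=\sum_i\overline{x_i}y_i$, $\|x\|=\sqrt{\langle x,x\rangle}$, $M^*={}^t\overline{M}$. $U_m(\mathbb{K})=\{M: MM^*=I_m\}$; $SL_m(\mathbb{K})$ is the group of determinant $1$ matrices (Dieudonné determinant if $\mathbb{K}=\mathbb{H}$; equivalently, for $\mathbb{H}$, the automorphisms preserving a Haar measure of $\mathbb{H}^m$); $SU_m(\mathbb{K})=U_m(\mathbb{K})\cap SL_m(\mathbb{K})$. The order $\mathcal{O}$: if $\mathbb{K}=\mathbb{R}$, $\mathcal{O}=\mathbb{Z}$; if $\mathbb{K}=\mathbb{C}$, $\mathcal{O}$ is an order in an imaginary quadratic field embedded in $\mathbb{C}$; if $\mathbb{K}=\mathbb{H}$, $\mathcal{O}$ is an order in a quaternion algebra $A$ over $\mathbb{Q}$ not split over $\mathbb{R}$,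 with $A\otimes_{\mathbb{Q}}\mathbb{R}=\mathbb{H}$. Marked lattices. An $\mathcal{O}$-lattice of $\mathbb{K}^m$ is a right $\mathcal{O}$-submodule generated by a $\mathbb{K}$-basis of $\mathbb{K}^m$; covolume is normalized so that $\mathcal{O}^m$ has covolume $1$. A marked lattice is a morphism of right $\mathcal{O}$-modules $f:\mathcal{O}^m\to\mathbb{K}^m$ whose image is a lattice; it extends uniquely to a $\mathbb{K}$-linear automorphism of $\mathbb{K}^m$, denoted by the same letter. The space of classes of marked lattices of covolume $1$ modulo $f\sim k\circ f$ ($k\in U_m(\mathbb{K})$) is identified with $\mathcal{E}_m=SL_m(\mathbb{K})/SU_m(\mathbb{K})$ by $\gamma\,SU_m(\mathbb{K})\mapsto[\gamma^*|_{\mathcal{O}^m}]$; the left translation action of $g\in SL_m(\mathbb{K})$ becomes $g\cdot[f]=[f\circ g^*]$. Thurston compactification. For a set $E$, $\mathbb{P}(\mathbb{R}_+^{E})$ is the quotient of $\mathbb{R}_+^E\setminus\{0\}$ (product topology) by homotheties of positive ratio. The map $\phi:\mathcal{E}_m\to\mathbb{P}(\mathbb{R}_+^{\mathcal{O}^m})$, $[f]\mapsto[u\mapsto\|f(u)\|]$, is an embedding, and $\overline{\mathcal{E}_m}^{\mathcal{T}}$ is the closure of its image. It is compact and its points are exactly the classes of the functions $\ell_f:u\mapsto\|f(u)\|$, $f$ a nonzero endomorphism of $\mathbb{K}^m$; the group $SL_m(\mathbb{K})$ acts continuously on it by $g\cdot[\ell_f]=[\ell_{f\circ g^*}]$. Satake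 compactification. Let $\mathrm{Sym}(\mathbb{K}^m)$ be the real vector space of hermitian matrices ($M=M^*$), with $SL_m(\mathbb{K})$ acting on its real projective space by $g\cdot\mathbb{R}h=\mathbb{R}\,ghg^*$. The map $\mathcal{E}_m\to\mathbb{P}(\mathrm{Sym}(\mathbb{K}^m))$, $\gamma\,SU_m(\mathbb{K})\mapsto\mathbb{R}\,\gamma\gamma^*$, is an equivariant embedding, and $\overline{\mathcal{E}_m}^{\mathcal{S}}$ is the closure of its image (the Satake compactification associated with the tautological representation). A compactification of a locally compact space $X$ is a pair $(C,i)$ with $C$ compact and $i:X\to C$ an embedding with dense image; it is a $G$-compactification if the $G$-action on $X$ extends continuously to $C$. Two $G$-compactifications $(C,i)$, $(C',i')$ are $G$-isomorphic if there is a $G$-equivariant homeomorphism $F:C\to C'$ with $i'=F\circ i$. *)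

(* Defs.v *)
From HB Require Import structures.
From mathcomp Require Import all_boot all_order all_algebra.
From mathcomp Require Import generic_quotient.
From mathcomp Require Import complex.
From mathcomp Require Import all_classical all_reals.
From mathcomp Require Import topology normedtype.
From mathcomp Require Import ring lra.

Set Implicit Arguments.
Unset Strict Implicit.
Unset Printing Implicit Defensive.

Import Order.TTheory GRing.Theory Num.Theory.
Import numFieldNormedType.Exports.

Local Open Scope classical_set_scope.
Local Open Scope ring_scope.

(* [Quat a b c d] is a + b i + c j + d k. *)
Record quat (T : Type) := Quat { q0 : T; q1 : T; q2 : T; q3 : T }.

Section QuatChoice.
Variable T : Type.
Definition quat_to_tuple (q : quat T) := (q0 q, q1 q, q2 q, q3 q).
Definition quat_of_tuple (t : T * T * T * T) :=
  Quat t.1.1.1 t.1.1.2 t.1.2 t.2.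
Lemma quat_to_tupleK : cancel quat_to_tuple quat_of_tuple.
Proof. by case. Qed.
End QuatChoice.

HB.instance Definition _ (T : choiceType) :=
  Choice.copy (quat T) (can_type (@quat_to_tupleK T)).

Section QuatRing.
Variable R : realFieldType.
Implicit Types p q : quat R.

Lemma eq_quat p q :
  q0 p = q0 q -> q1 p = q1 q -> q2 p = q2 q -> q3 p = q3 q -> p = q.
Proof. by case: p q => [a b c d] [e f g h] /= -> -> -> ->. Qed.

Definition addq p q :=
  Quat (q0 p + q0 q) (q1 p + q1 q) (q2 p + q2 q) (q3 p + q3 q).
Definition oppq p := Quat (- q0 p) (- q1 p) (- q2 p) (- q3 p).
Definition mulq p q :=
  Quat (q0 p * q0 q - q1 p * q1 q - q2 p * q2 q - q3 p * q3 q)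
       (q0 p * q1 q + q1 p * q0 q + q2 p * q3 q - q3 p * q2 q)
       (q0 p * q2 q - q1 p * q3 q + q2 p * q0 q + q3 p * q1 q)
       (q0 p * q3 q + q1 p * q2 q - q2 p * q1 q + q3 p * q0 q).
Definition conjq p := Quat (q0 p) (- q1 p) (- q2 p) (- q3 p).
Definition normq2 p := q0 p ^+ 2 + q1 p ^+ 2 + q2 p ^+ 2 + q3 p ^+ 2.
Definition realq (x : R) := Quat x 0 0 0.
Definition invq p := mulq (realq (normq2 p)^-1) (conjq p).

Lemma addqA : associative addq.
Proof. by move=> p q r; apply: eq_quat => /=; ring. Qed.
Lemma addqC : commutative addq.
Proof. by move=> p q; apply: eq_quat => /=; ring. Qed.
Lemma add0q : left_id (realq 0) addq.
Proof. by move=> p; apply: eq_quat => /=; ring. Qed.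
Lemma addNq : left_inverse (realq 0) oppq addq.
Proof. by move=> p; apply: eq_quat => /=; ring. Qed.

HB.instance Definition _ :=
  GRing.isZmodule.Build (quat R) addqA addqC add0q addNq.

Lemma mulqA : associative mulq.
Proof. by move=> p q r; apply: eq_quat => /=; ring. Qed.
Lemma mul1q : left_id (realq 1) mulq.
Proof. by move=> p; apply: eq_quat => /=; ring. Qed.
Lemma mulq1 : right_id (realq 1) mulq.
Proof. by move=> p; apply: eq_quat => /=; ring. Qed.
Lemma mulqDl : left_distributive mulq addq.
Proof. by move=> p q r; apply: eq_quat => /=; ring. Qed.
Lemma mulqDr : right_distributive mulq addq.
Proof. by move=> p q r; apply: eq_quat => /=; ring. Qed.
Lemma oneq_neq0 : realq 1 != realq 0.
Proof. by apply/eqP => -[] /eqP; rewrite oner_eq0. Qed.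

HB.instance Definition _ := GRing.Zmodule_isNzRing.Build (quat R)
  mulqA mul1q mulq1 mulqDl mulqDr oneq_neq0.

Lemma normq2_eq0 p : (normq2 p == 0) = (p == 0).
Proof.
apply/eqP/eqP => [|->]; last by rewrite /normq2 /= !expr0n /= !addr0.
move=> /eqP; rewrite /normq2 !paddr_eq0 ?addr_ge0 ?sqr_ge0 // !sqrf_eq0.
by move=> /andP[/andP[/andP[/eqP a /eqP b] /eqP c] /eqP d]; apply: eq_quat.
Qed.

Lemma mulVq : {in [pred p | p != 0], left_inverse 1 invq *%R}.
Proof.
move=> p; rewrite inE -normq2_eq0 => p0.
by apply: eq_quat => /=; rewrite /normq2 in p0 *; field.
Qed.
Lemma mulqV : {in [pred p | p != 0], right_inverse 1 invq *%R}.
Proof.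
move=> p; rewrite inE -normq2_eq0 => p0.
by apply: eq_quat => /=; rewrite /normq2 in p0 *; field.
Qed.
Lemma unitqP p q : q * p = 1 /\ p * q = 1 -> p != 0.
Proof.
by case=> qp _; apply/eqP => p0; move/eqP: qp; rewrite p0 mulr0 eq_sym oner_eq0.
Qed.
Lemma invq_out : {in [predC [pred p | p != 0]], invq =1 id}.
Proof.
move=> p; rewrite !inE negbK => /eqP ->.
by apply: eq_quat => /=; ring.
Qed.

HB.instance Definition _ :=
  GRing.NzRing_hasMulInverse.Build (quat R) mulVq mulqV unitqP invq_out.

Lemma unitqE p : (p \is a GRing.unit) = (p != 0).
Proof. by []. Qed.

End QuatRing.

Variant skewfield := RealK | ComplexK | QuaternionK.

Section Scalars.
Variable R : realType.

Definition Kof (k : skewfield) : unitRingType :=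
  match k with
  | RealK => R
  | ComplexK => R[i]
  | QuaternionK => quat R
  end.

Definition toH (k : skewfield) : Kof k -> quat R :=
  match k with
  | RealK => fun x : R => Quat x 0 0 0
  | ComplexK => fun z : R[i] => Quat (complex.Re z) (complex.Im z) 0 0
  | QuaternionK => fun q : quat R => q
  end.

Definition realK (k : skewfield) : R -> Kof k :=
  match k with
  | RealK => fun x : R => x
  | ComplexK => fun x : R => Complex x 0
  | QuaternionK => fun x : R => Quat x 0 0 0
  end.

Definition conjK (k : skewfield) : Kof k -> Kof k :=
  match k with
  | RealK => fun x : R => x
  | ComplexK => fun z : R[i] => conjc z
  | QuaternionK => fun q : quat R => conjq q
  end.

Definition reK (k : skewfield) (x : Kof k) : R := q0 (toH x).

Lemma toH_inj k : injective (@toH k).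
Proof.
case: k => /=; last by [].
- by move=> x y [].
- by move=> [a b] [c d] /= [-> ->].
Qed.
Lemma toHD k : {morph @toH k : x y / x + y}.
Proof.
case: k => //=.
- by move=> x y; apply: eq_quat => /=; ring.
- by move=> [a b] [c d]; apply: eq_quat => /=; ring.
Qed.
Lemma toHM k : {morph @toH k : x y / x * y}.
Proof.
case: k => //=.
- by move=> x y; apply: eq_quat => /=; ring.
- by move=> [a b] [c d]; apply: eq_quat => /=; ring.
Qed.
Lemma toH0 k : toH (0 : Kof k) = 0. Proof. by case: k. Qed.
Lemma toH1 k : toH (1 : Kof k) = 1. Proof. by case: k. Qed.
Lemma toH_conj k (x : Kof k) : toH (conjK x) = conjq (toH x).
Proof.
case: k x => [x|[a b]|x] //=; last by rewrite /conjq /= oppr0.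
by rewrite /conjq /= oppr0.
Qed.
Lemma toH_real k (x : R) : toH (realK k x) = realq x.
Proof. by case: k. Qed.

End Scalars.
Arguments toH {R k}.
Arguments realK {R} k.
Arguments conjK {R k}.
Arguments reK {R k}.

Section Dieudonne.
Variables (D : unitRingType) (m : nat).
Local Notation n := m.+1.
Implicit Types (d x y : D) (A B E : 'M[D]_n).

Definition transvection (i j : 'I_n) (a : D) : 'M[D]_n :=
  1%:M + a *: delta_mx i j.

Inductive transvections : 'M[D]_n -> Prop :=
| transvections1 : transvections 1%:M
| transvectionsM i j a A : i != j -> transvections A ->
    transvections (transvection i j a *m A).

Inductive commutators : D -> Prop :=
| commutators1 : commutators 1
| commutatorsM x y d : x \is a GRing.unit -> y \is a GRing.unit ->
    commutators d -> commutators (x * y * x^-1 * y^-1 * d).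

Definition diag_last d : 'M[D]_n :=
  diag_mx (\row_(i < n) if i == ord_max then d else 1).

(* The class of d modulo [D^*, D^*] is the Dieudonne determinant of A: over a
   skew field, every invertible A is E diag(1, ..., 1, d) with E a product of
   transvections, and det A is by definition the class of d. *)
Definition Dieudonne_det A d :=
  d \is a GRing.unit /\ exists2 E, transvections E & A = E *m diag_last d.

Definition Dieudonne_det1 A := exists2 d, commutators d & Dieudonne_det A d.

Lemma transvectionsMm A B :
  transvections A -> transvections B -> transvections (A *m B).
Proof.
by elim=> [|i j a E ij _ IH] tB; rewrite ?mul1mx // -mulmxA; constructor; auto.
Qed.

Lemma transvectionK i j a : i != j ->
  transvection i j a *m transvection i j (- a) = 1%:M.
Proof.
move=> ij; rewrite /transvection mulmxDl mul1mx mulmxDr mulmx1 scaleNr.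
rewrite addrA subrK mulmxN -scalemxAl.
have -> : delta_mx i j *m (a *: delta_mx i j) = 0.
  apply/matrixP => u v; rewrite !mxE big1 // => w _; rewrite !mxE.
  case: (eqVneq w j) => [->|_]; last by rewrite andbF mul0r.
  by rewrite (eq_sym j i) (negbTE ij) !mulr0.
by rewrite scaler0 subr0.
Qed.

Lemma transvections_inv A : transvections A ->
  exists2 B, transvections B & A *m B = 1%:M /\ B *m A = 1%:M.
Proof.
elim=> [|i j a E ij _ [B tB [EB BE]]].
  by exists 1%:M; [constructor|rewrite mulmx1].
exists (B *m transvection i j (- a)).
  apply: transvectionsMm => //; rewrite -[transvection _ _ _]mulmx1.
  by constructor => //; constructor.
split; rewrite -mulmxA.
  by rewrite [E *m _]mulmxA EB mul1mx transvectionK.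
by rewrite [_ *m (_ *m E)]mulmxA -{2}(opprK a) transvectionK // mul1mx.
Qed.

Lemma diag_lastM x y : diag_last x *m diag_last y = diag_last (x * y).
Proof.
apply/matrixP => i j; rewrite mul_diag_mx !mxE.
by case: (i == ord_max); case: (eqVneq i j) => _; rewrite ?mulr1n ?mulr0n ?mulr0
  ?mulr1.
Qed.

Lemma diag_last1 : diag_last 1 = 1%:M.
Proof. by apply/matrixP => i j; rewrite !mxE if_same. Qed.

Lemma diag_last_conj d A : d \is a GRing.unit -> transvections A ->
  exists2 B, transvections B & diag_last d *m A = B *m diag_last d.
Proof.
move=> ud; elim=> [|i j a E ij _ [B tB eB]].
  by exists 1%:M; [constructor|rewrite mulmx1 mul1mx].
pose c (l : 'I_n) := if l == ord_max then d else 1.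
have uc l : c l \is a GRing.unit by rewrite /c; case: ifP => // _; exact: unitr1.
exists (transvection i j (c i * a * (c j)^-1) *m B); first by constructor.
rewrite -mulmxA -eB !mulmxA; congr (_ *m _).
apply/matrixP => u v; rewrite mul_diag_mx mul_mx_diag !mxE -/(c u) -/(c v).
rewrite mulrDr mulrDl; congr (_ + _).
  by case: eqVneq => [->|_]; rewrite ?mulr1 ?mul1r ?mulr0 ?mul0r.
case: (eqVneq u i) => [->|_] /=; last by rewrite !mulr0 mul0r.
case: (eqVneq v j) => [->|_] /=; last by rewrite !mulr0 mul0r.
by rewrite !mulr1 mulrVK.
Qed.

Lemma commutatorsMm x y : commutators x -> commutators y -> commutators (x * y).
Proof.
by elim=> [|u v d uu uv _ IH] cy; rewrite ?mul1r // -mulrA; constructor; auto.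
Qed.

Lemma commutators_unit x : commutators x -> x \is a GRing.unit.
Proof.
by elim=> [|u v d uu uv _ IH]; rewrite ?unitr1 // !unitrMr ?unitrV.
Qed.

Lemma commutatorsV x : commutators x -> commutators x^-1.
Proof.
elim=> [|u v d uu uv cd IH]; first by rewrite invr1; constructor.
have ud := commutators_unit cd.
rewrite !invrM ?invrK ?unitrMr ?unitrV //.
apply: commutatorsMm => //; rewrite -[X in commutators X]mulr1 !mulrA.
by constructor=> //; constructor.
Qed.

Lemma Dieudonne_det1_mx1 : Dieudonne_det1 1%:M.
Proof.
exists 1; first by constructor.
split; first exact: unitr1.
by exists 1%:M; [constructor|rewrite diag_last1 mul1mx].
Qed.

Lemma Dieudonne_det1M A B :
  Dieudonne_det1 A -> Dieudonne_det1 B -> Dieudonne_det1 (A *m B).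
Proof.
move=> [x cx [ux [E tE ->]]] [y cy [uy [E' tE' ->]]].
exists (x * y); first exact: commutatorsMm.
split; first by rewrite unitrMr.
have [E'' tE'' e] := diag_last_conj ux tE'.
exists (E *m E''); first exact: transvectionsMm.
by rewrite -diag_lastM -!mulmxA; congr (_ *m _); rewrite !mulmxA e.
Qed.

Lemma Dieudonne_det1V A : Dieudonne_det1 A ->
  exists2 B, Dieudonne_det1 B & A *m B = 1%:M /\ B *m A = 1%:M.
Proof.
move=> [x cx [ux [E tE ->]]].
have [E' tE' [EE' E'E]] := transvections_inv tE.
have ux' : x^-1 \is a GRing.unit by rewrite unitrV.
exists (diag_last x^-1 *m E').
  have [E'' tE'' e] := diag_last_conj ux' tE'.
  exists x^-1; first exact: commutatorsV.
  by split => //; exists E''.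
split; rewrite -mulmxA.
  by rewrite [diag_last x *m _]mulmxA diag_lastM divrr // diag_last1 mul1mx.
by rewrite [E' *m _]mulmxA E'E mul1mx diag_lastM mulVr // diag_last1.
Qed.

End Dieudonne.

Section Groups.
Variables (R : realType) (k : skewfield).
Local Notation K := (Kof R k).

Lemma conjK_is_additive : {morph @conjK R k : x y / x + y}.
Proof.
move=> x y; apply: (@toH_inj R k).
by rewrite toHD !toH_conj toHD; apply: eq_quat => /=; ring.
Qed.
Lemma conjKM x y : conjK (x * y : K) = conjK y * conjK x.
Proof.
by apply: (@toH_inj R k); rewrite toHM !toH_conj toHM; apply: eq_quat => /=; ring.
Qed.
Lemma conjK0 : conjK (0 : K) = 0.
Proof. by apply: (@toH_inj R k); rewrite toH_conj toH0; apply: eq_quat => /=; ring. Qed.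
Lemma conjK1 : conjK (1 : K) = 1.
Proof. by apply: (@toH_inj R k); rewrite toH_conj toH1; apply: eq_quat => /=; ring. Qed.
Lemma conjKK : involutive (@conjK R k).
Proof.
by move=> x; apply: (@toH_inj R k); rewrite !toH_conj; apply: eq_quat => /=; ring.
Qed.
Lemma conjK_sum I (r : seq I) (F : I -> K) :
  conjK (\sum_(i <- r) F i) = \sum_(i <- r) conjK (F i).
Proof. exact: (big_morph _ conjK_is_additive conjK0). Qed.

Lemma realKM : {morph @realK R k : x y / x * y}.
Proof.
move=> x y; apply: (@toH_inj R k); rewrite toHM !toH_real.
by apply: eq_quat => /=; ring.
Qed.
Lemma realK1 : @realK R k 1 = 1.
Proof. by apply: (@toH_inj R k); rewrite toH1 toH_real. Qed.
Lemma realK_comm c (x : K) : realK k c * x = x * realK k c.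
Proof.
by apply: (@toH_inj R k); rewrite !toHM !toH_real; apply: eq_quat => /=; ring.
Qed.

Lemma realK_scaler p q r c (A : 'M[K]_(p, q)) (B : 'M[K]_(q, r)) :
  A *m (realK k c *: B) = realK k c *: (A *m B).
Proof.
apply/matrixP => i j; rewrite !mxE mulr_sumr; apply: eq_bigr => l _.
by rewrite !mxE !mulrA realK_comm.
Qed.

Definition adjmx p q (A : 'M[K]_(p, q)) : 'M[K]_(q, p) := (map_mx conjK A)^T.

Lemma adjmxK p q (A : 'M[K]_(p, q)) : adjmx (adjmx A) = A.
Proof. by apply/matrixP => i j; rewrite !mxE conjKK. Qed.
Lemma adjmxM p q r (A : 'M[K]_(p, q)) (B : 'M[K]_(q, r)) :
  adjmx (A *m B) = adjmx B *m adjmx A.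
Proof.
apply/matrixP => i j; rewrite !mxE conjK_sum; apply: eq_bigr => l _.
by rewrite !mxE conjKM.
Qed.
Lemma adjmx0 p q : adjmx (0 : 'M[K]_(p, q)) = 0.
Proof. by apply/matrixP => i j; rewrite !mxE conjK0. Qed.
Lemma adjmxD p q (A B : 'M[K]_(p, q)) : adjmx (A + B) = adjmx A + adjmx B.
Proof. by apply/matrixP => i j; rewrite !mxE conjK_is_additive. Qed.

Lemma adjmx1 p : adjmx (1%:M : 'M[K]_p) = 1%:M.
Proof.
apply/matrixP => i j; rewrite !mxE eq_sym.
by case: (i == j); rewrite ?mulr1n ?mulr0n ?conjK0 ?conjK1.
Qed.

Definition inner p (x y : 'cV[K]_p) : K := \sum_i conjK (x i 0) * y i 0.

Definition vnorm p (x : 'cV[K]_p) : R := Num.sqrt (reK (inner x x)).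

Lemma reKD : {morph @reK R k : x y / x + y}.
Proof. by move=> x y; rewrite /reK toHD. Qed.
Lemma reK0 : reK (0 : K) = 0. Proof. by rewrite /reK toH0. Qed.
Lemma reK_sum I (r : seq I) (F : I -> K) :
  reK (\sum_(i <- r) F i) = \sum_(i <- r) reK (F i).
Proof. exact: (big_morph _ reKD reK0). Qed.
Lemma reK_conjM x : reK (conjK x * x : K) = normq2 (toH x).
Proof. by rewrite /reK toHM toH_conj /= /normq2; ring. Qed.

Lemma innerE p (x y : 'cV[K]_p) : inner x y = (adjmx x *m y) 0 0.
Proof. by rewrite mxE; apply: eq_bigr => i _; rewrite !mxE. Qed.

Lemma reK_inner_ge0 p (x : 'cV[K]_p) : 0 <= reK (inner x x).
Proof.
rewrite reK_sum sumr_ge0 // => i _; rewrite reK_conjM /normq2.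
by rewrite !addr_ge0 ?sqr_ge0.
Qed.

Lemma vnorm_eq0 p (x : 'cV[K]_p) : (vnorm x == 0) = (x == 0).
Proof.
rewrite sqrtr_eq0 le_eqVlt ltNge reK_inner_ge0 orbF reK_sum.
rewrite psumr_eq0; last first.
  by move=> i _; rewrite reK_conjM /normq2 !addr_ge0 ?sqr_ge0.
apply/allP/eqP => [x0|-> i _]; last by rewrite !mxE mulr0 reK0 eqxx.
apply/matrixP => i j; rewrite ord1 !mxE; apply: (@toH_inj R k).
have := x0 i (mem_index_enum _); rewrite reK_conjM normq2_eq0 => /eqP ->.
by rewrite toH0.
Qed.

Definition rinner p (x y : 'cV[K]_p) : R := reK (inner x y).

Lemma rinnerC p (x y : 'cV[K]_p) : rinner x y = rinner y x.
Proof.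
rewrite /rinner !reK_sum; apply: eq_bigr => i _.
by rewrite /reK !toHM !toH_conj /=; ring.
Qed.
Lemma rinnerDr p (x y z : 'cV[K]_p) : rinner x (y + z) = rinner x y + rinner x z.
Proof. by rewrite /rinner -reKD !innerE mulmxDr mxE. Qed.
Lemma rinnerZr p c (x y : 'cV[K]_p) : rinner x (realK k c *: y) = c * rinner x y.
Proof.
rewrite /rinner !innerE realK_scaler mxE /reK toHM toH_real /=; ring.
Qed.
Lemma rinner0r p (x : 'cV[K]_p) : rinner x 0 = 0.
Proof. by rewrite /rinner innerE mulmx0 mxE reK0. Qed.
Lemma rinnerxx p (x : 'cV[K]_p) : rinner x x = vnorm x ^+ 2.
Proof. by rewrite /vnorm sqr_sqrtr // reK_inner_ge0. Qed.
Lemma rinnerxDx p (x y : 'cV[K]_p) :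
  rinner (x + y) (x + y) = rinner x x + rinner y y + 2 * rinner x y.
Proof.
rewrite rinnerDr ![rinner (x + y) _]rinnerC !rinnerDr (rinnerC y x); ring.
Qed.
Lemma vnorm_adj p q (A B : 'M[K]_(p, q)) (x : 'cV[K]_p) :
  A *m adjmx A = B *m adjmx B -> vnorm (adjmx A *m x) = vnorm (adjmx B *m x).
Proof.
move=> AB; rewrite /vnorm !innerE !adjmxM !adjmxK !mulmxA.
by rewrite -(mulmxA _ A) AB !mulmxA.
Qed.

Variable m : nat.
Local Notation n := m.+1.

Definition det1 : 'M[K]_n -> Prop :=
  match k return 'M[Kof R k]_n -> Prop with
  | RealK => fun A : 'M[R]_n => \det A = 1
  | ComplexK => fun A : 'M[R[i]]_n => \det A = 1
  | QuaternionK => fun A : 'M[quat R]_n => Dieudonne_det1 A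
  end.

Definition SL : {pred 'M[K]_n} := [pred A | `[< det1 A >]].
Definition U : {pred 'M[K]_n} := [pred A | A *m adjmx A == 1%:M].
Definition SU : {pred 'M[K]_n} := [pred A | (A \in U) && (A \in SL)].

Lemma SLP A : reflect (det1 A) (A \in SL).
Proof. exact: asboolP. Qed.
End Groups.

Lemma SL1 (R : realType) k m : 1%:M \in @SL R k m.
Proof.
apply/SLP; case: k => /=; [exact: matrix.det1|exact: matrix.det1|exact: Dieudonne_det1_mx1].
Qed.

Lemma SLM (R : realType) k m (A B : 'M_m.+1) :
  A \in @SL R k m -> B \in @SL R k m -> A *m B \in @SL R k m.
Proof.
move=> /SLP + /SLP + ; move=> hA hB; apply/SLP; case: k A B hA hB => /=.
- by move=> A B hA hB; rewrite det_mulmx hA hB mulr1.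
- by move=> A B hA hB; rewrite det_mulmx hA hB mulr1.
- by move=> A B; exact: Dieudonne_det1M.
Qed.

Lemma SLV (R : realType) k m (A : 'M_m.+1) : A \in @SL R k m ->
  exists2 B, B \in @SL R k m & A *m B = 1%:M /\ B *m A = 1%:M.
Proof.
move=> /SLP; case: k A => /= A.
- move=> hA; have uA : A \in unitmx by rewrite unitmxE hA unitr1.
  exists (invmx A); last by rewrite mulmxV // mulVmx.
  by apply/SLP; rewrite /= det_inv hA invr1.
- move=> hA; have uA : A \in unitmx by rewrite unitmxE hA unitr1.
  exists (invmx A); last by rewrite mulmxV // mulVmx.
  by apply/SLP; rewrite /= det_inv hA invr1.
- by move=> /Dieudonne_det1V[B hB AB]; exists B => //; apply/SLP.
Qed.

Section Orders.
Variable R : realType.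

(* e is a basis of A over F, where F is embedded in D by iota. *)
Definition is_basis_over (F : nzRingType) (D : nzRingType) (iota : F -> D)
    (p : nat) (e : 'I_p -> D) (A : {pred D}) :=
  (forall x, x \in A <-> exists c : 'I_p -> F, x = \sum_i iota (c i) * e i) /\
  (forall c : 'I_p -> F, \sum_i iota (c i) * e i = 0 -> forall i, c i = 0).

(* O is an order in the Q-algebra A: a subring of A, finitely generated as a
   Z-module, which spans A over Q. *)
Definition is_order_in (D : nzRingType) (A O : {pred D}) :=
  [/\ GRing.subring_closed O, {subset O <= A},
      exists p (e : 'I_p -> D), forall x,
        x \in O <-> exists c : 'I_p -> int, x = \sum_i e i *~ c i
    & forall x, x \in A -> exists2 N, (0 < N)%N & x *+ N \in O].

Definition imaginary_quadratic_field (L : {pred R[i]}) :=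
  [/\ GRing.divring_closed L,
      exists e : 'I_2 -> R[i], is_basis_over ratr e L
    & exists2 z, z \in L & complex.Im z != 0].

(* A is a quaternion algebra (a, b | Q) contained in H, and a Q-basis of A is an
   R-basis of H: this is the identification of A (x)_Q R with H. *)
Definition quaternion_algebra_form (A : {pred quat R}) :=
  exists (a b : rat) (x y : quat R),
    let e := tnth [tuple 1; x; y; x * y] in
    [/\ a != 0 /\ b != 0,
        [/\ x * x = ratr a, y * y = ratr b & x * y = - (y * x)],
        is_basis_over ratr e A
      & is_basis_over (@realq R) e predT].

Definition is_order (k : skewfield) : {pred Kof R k} -> Prop :=
  match k return {pred Kof R k} -> Prop with
  | RealK => fun O : {pred R} => O =i Num.int
  | ComplexK => fun O : {pred R[i]} =>
      exists2 L, imaginary_quadratic_field L & is_order_in L O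
  | QuaternionK => fun O : {pred quat R} =>
      exists2 A, quaternion_algebra_form A & is_order_in A O
  end.

Record orderOf (k : skewfield) := OrderOf {
  oset : {pred Kof R k};
  oset_is_order : is_order oset }.

Lemma oset_subring k (O : orderOf k) : GRing.subring_closed (oset O).
Proof.
case: O => O /=; case: k O => /= O.
- move=> OE; split=> [|x y|x y]; rewrite !OE.
  + exact: rpred1.
  + exact: rpredB.
  + exact: rpredM.
- by case=> L _ [].
- by case=> A _ [].
Qed.

Lemma oset_span k (O : orderOf k) (x : Kof R k) :
  exists p (c : 'I_p -> R) (w : 'I_p -> Kof R k),
    (forall i, w i \in oset O) /\ x = \sum_i realK k (c i) * w i.
Proof.
case: O => O /=; case: k O x => /= O.
- move=> x OE; exists 1%N, (fun=> x), (fun=> 1); split.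
    by move=> _; rewrite OE rpred1.
  by rewrite big_ord1 mulr1.
- move=> [x1 x2] [L [_ _ [[z1 z2] Lz /= z0]] [[O1 _ _] _ _ /(_ _ Lz)[N N0 ON]]].
  have N0' : N%:R != 0 :> R by rewrite pnatr_eq0 -lt0n.
  pose b := x2 / (N%:R * z2).
  exists 2%N, (tnth [tuple x1 - b * (N%:R * z1); b]),
    (tnth [tuple 1; Complex z1 z2 *+ N]); split.
    by move=> i; case: (unliftP ord0 i) => [j|] -> //; rewrite ord1.
  rewrite !big_ord_recl big_ord0 /tnth /= -[Complex z1 z2 *+ N]mulr_natl.
  have -> : (N%:R : R[i]) = Complex N%:R 0.
    by rewrite -(rmorph_nat (real_complex R)).
  apply/eqP; rewrite eq_complex /=; apply/andP; split; apply/eqP.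
    by rewrite /b; ring.
  rewrite /b; move: (N%:R : R) N0' => t t0; field; by rewrite ?t0 ?z0.
- move=> x [A [a [b [y [z /= [_ _ hA [hH _]]]]]] [_ _ _ hO]].
  have [/(_ isT)[c ->] _] := hH x.
  set e := tnth _ in hA hH *.
  have /all_sig2[N N0 ON] : forall i : 'I_4, {N | (0 < N)%N & e i *+ N \in O}.
    move=> i; apply/cid2/hO; have [hAA _] := hA; apply/hAA.
    exists (fun j => (i == j)%:R); rewrite (bigD1 i) //= eqxx.
    rewrite {1}/ratr divr1 mul1r.
    rewrite big1 ?addr0 // => j; rewrite eq_sym => /negbTE ->.
    by rewrite /ratr !mul0r.
  exists 4%N, (fun i => c i / (N i)%:R), (fun i => e i *+ N i); split => //.
  apply: eq_bigr => i _; rewrite -[e i *+ N i]mulr_natl mulrA; congr (_ * _).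
  have -> : ((N i)%:R : quat R) = realq (N i)%:R.
    elim: (N i) => // j IH; rewrite -!natr1 IH.
    by apply: eq_quat => /=; ring.
  have N0' : (N i)%:R != 0 :> R by rewrite pnatr_eq0 -lt0n.
  by apply: eq_quat => /=; move: ((N i)%:R : R) N0' => t t0; field.
Qed.

End Orders.

(* From here on the dimension is m = n.+1 >= 1. *)

Section SymmetricSpace.
Variables (R : realType) (k : skewfield) (n : nat).
Local Notation K := (Kof R k).
Local Notation m := n.+1.
Local Open Scope quotient_scope.

Definition SLtype := {g : 'M[K]_m | g \in @SL R k n}.
Definition nonzero_mx := {f : 'M[K]_m | f != 0}.

Lemma U_unitary (u v : 'M[K]_m) :
  u \in @U R k n -> u *m v = 1%:M -> v *m u = 1%:M -> v = adjmx u.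
Proof.
by move=> /eqP uU uv vu; rewrite -[LHS]mulmx1 -uU mulmxA vu mul1mx.
Qed.

Definition SU_coset (g h : SLtype) :=
  `[< exists2 u, u \in @SU R k n & val h = val g *m u >].

Lemma SU_coset_refl : reflexive SU_coset.
Proof.
move=> g; apply/asboolP; exists 1%:M; last by rewrite mulmx1.
by rewrite inE SL1 andbT inE adjmx1 mulmx1.
Qed.
Lemma SU_coset_sym : symmetric SU_coset.
Proof.
suff H g h : SU_coset g h -> SU_coset h g by move=> g h; apply/idP/idP; exact: H.
move=> /asboolP[u /andP[uU uSL] hg]; apply/asboolP.
have [v vSL [uv vu]] := SLV uSL; exists v; last by rewrite hg -mulmxA uv mulmx1.
rewrite inE vSL andbT inE (U_unitary uU uv vu) adjmxK -(U_unitary uU uv vu) vu.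
exact: eqxx.
Qed.
Lemma SU_coset_trans : transitive SU_coset.
Proof.
move=> h g l /asboolP[u /andP[/eqP uU uSL] hg] /asboolP[v /andP[/eqP vU vSL] lh].
apply/asboolP; exists (u *m v); last by rewrite lh hg mulmxA.
rewrite inE SLM // andbT inE adjmxM mulmxA -[u *m v *m _]mulmxA vU mulmx1 uU.
exact: eqxx.
Qed.

Canonical SU_coset_equiv :=
  EquivRel SU_coset SU_coset_refl SU_coset_sym SU_coset_trans.

Definition symspace := {eq_quot SU_coset_equiv}%qT.

Lemma mulmx_adj_neq0 (f : nonzero_mx) (g : SLtype) :
  val f *m adjmx (val g) != 0.
Proof.
have [h _ [gh hg]] := SLV (valP g); apply: contra (valP f) => /eqP fg0.
apply/eqP; rewrite -[LHS]mulmx1 -adjmx1 -hg adjmxM mulmxA.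
by rewrite [_ *m adjmx (val g)]fg0 mul0mx.
Qed.
Definition mulmx_adj (f : nonzero_mx) (g : SLtype) : nonzero_mx :=
  exist (fun f => is_true (f != 0)) _ (mulmx_adj_neq0 f g).

Lemma mx1_neq0 : (1%:M : 'M[K]_m) != 0.
Proof.
by apply/eqP => /matrixP/(_ 0 0)/eqP; rewrite !mxE eqxx oner_eq0.
Qed.
Definition nonzero_mx1 : nonzero_mx := exist (fun f => is_true (f != 0)) _ mx1_neq0.

End SymmetricSpace.

Section ProjectiveCone.
Variables (R : realType) (E : Type).

Definition cone : set {ptws E -> R} :=
  [set l | (forall u, 0 <= l u) /\ (exists u, l u != 0)].

Definition homothetic (l l' : cone) :=
  `[< exists2 c : R, 0 < c & forall u, val l' u = c * val l u >].

Lemma homothetic_refl : reflexive homothetic.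
Proof. by move=> l; apply/asboolP; exists 1 => // u; rewrite mul1r. Qed.
Lemma homothetic_sym : symmetric homothetic.
Proof.
suff H l l' : homothetic l l' -> homothetic l' l.
  by move=> l l'; apply/idP/idP; exact: H.
move=> /asboolP[c c0 e]; apply/asboolP; exists c^-1; first by rewrite invr_gt0.
by move=> u; rewrite e mulKf // gt_eqF.
Qed.
Lemma homothetic_trans : transitive homothetic.
Proof.
move=> l' l l'' /asboolP[c c0 e] /asboolP[d d0 e']; apply/asboolP.
by exists (d * c) => [|u]; rewrite ?mulr_gt0 // e' e mulrA.
Qed.
Canonical homothetic_equiv :=
  EquivRel homothetic homothetic_refl homothetic_sym homothetic_trans.

Definition projcone := quotient_topology {eq_quot homothetic_equiv}%qT.
HB.instance Definition _ := Topological.copy projcone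
  (quotient_topology {eq_quot homothetic_equiv}%qT).

End ProjectiveCone.

Section Thurston.
Variables (R : realType) (k : skewfield) (O : orderOf R k) (n : nat).
Local Notation K := (Kof R k).
Local Notation m := n.+1.
Local Open Scope quotient_scope.

Definition std_lattice := {u : 'cV[K]_m | u \is a mxOver (oset O)}.

Definition ell (f : 'M[K]_m) : {ptws std_lattice -> R} :=
  fun u => vnorm (f *m val u).

Lemma ell_cone (f : nonzero_mx R k n) : @cone R std_lattice (ell (val f)).
Proof.
split=> [u|]; first exact: sqrtr_ge0.
have [j fj0] : exists j, val f *m delta_mx j (0 : 'I_1) != 0.
  apply/existsP; apply: contraR (valP f) => /existsPn f0; apply/eqP.
  apply/matrixP => i j; have := f0 j; rewrite negbK -colE => /eqP.
  by move=> /matrixP/(_ i 0); rewrite !mxE.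
have [O1 OB _] := oset_subring O.
have O0 : 0 \in oset O by rewrite -(subrr 1) OB.
have jO : (delta_mx j (0 : 'I_1) : 'cV[K]_m) \is a mxOver (oset O).
  by apply/mxOverP => i l; rewrite !mxE; case: (_ && _).
by exists (exist (fun u => is_true (u \is a mxOver (oset O))) _ jO); rewrite /ell vnorm_eq0.
Qed.

Definition ell_point (f : nonzero_mx R k n) : @cone R std_lattice :=
  SigSub (mem_set (ell_cone f)).

Definition thurston_space := projcone R std_lattice.
HB.instance Definition _ := Topological.on thurston_space.

Definition thurston_class (f : nonzero_mx R k n) : thurston_space :=
  \pi_(thurston_space) (ell_point f).

(* The class of g is sent to [l_(g^* )], the class of the marked lattice g^*;
   it does not depend on the representative by thurston_embE. *)
Definition thurston_emb (x : symspace R k n) : thurston_space :=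
  thurston_class (mulmx_adj (nonzero_mx1 R k n) (repr x)).

Definition thurston_closure : set thurston_space :=
  closure (range thurston_emb).

(* g.[l_f] = [l_(f o g^* )], which does not depend on f by thurston_actE below;
   every point of thurston_closure is of the form [l_f], so that the default
   value x is never used there. *)
Definition thurston_act (g : SLtype R k n) (x : thurston_space) :
    thurston_space :=
  if pselect (exists f, x = thurston_class f) is left xf
  then thurston_class (mulmx_adj (projT1 (cid xf)) g) else x.

Lemma thurston_classP f f' : reflect
  (exists2 c : R, 0 < c & forall u, ell (val f') u = c * ell (val f) u)
  (thurston_class f == thurston_class f').
Proof.
apply: (iffP idP) => [/eqP|[c c0 e]].
  by move=> /eqmodP/asboolP[c c0 e]; exists c.
by apply/eqP/eqmodP/asboolP; exists c.
Qed.

Lemma thurston_embE (g : SLtype R k n) :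
  thurston_emb (\pi_(symspace R k n) g)
  = thurston_class (mulmx_adj (nonzero_mx1 R k n) g).
Proof.
rewrite /thurston_emb; case: piP => h /eqmodP/asboolP[u /andP[/eqP uU _] hg].
apply/eqP/thurston_classP; exists 1 => // v; rewrite mul1r /ell /=.
rewrite !mul1mx; apply: vnorm_adj.
by rewrite hg adjmxM mulmxA -[_ *m u *m _]mulmxA uU mulmx1.
Qed.

Lemma std_lattice_ind (P : 'cV[K]_m -> Prop) :
  P 0 -> (forall x y, P x -> P y -> P (x + y)) ->
  (forall c x, P x -> P (realK k c *: x)) ->
  (forall u : std_lattice, P (val u)) -> forall x, P x.
Proof.
move=> P0 PD PZ PO x; rewrite [x]matrix_sum_delta.
apply: big_ind => // i _; rewrite big_ord1.
have [p [c [w [wO ->]]]] := oset_span O (x i 0).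
rewrite scaler_suml; apply: big_ind => // j _; rewrite -scalerA; apply: PZ.
have [O1 OB _] := oset_subring O.
have O0 : 0 \in oset O by rewrite -(subrr 1) OB.
have jO : (w j *: delta_mx i (0 : 'I_1) : 'cV[K]_m) \is a mxOver (oset O).
  by apply/mxOverP => a b; rewrite !mxE; case: (_ && _); rewrite ?mulr1 ?mulr0.
exact: (PO (exist (fun u => is_true (u \is a mxOver (oset O))) _ jO)).
Qed.

Lemma ell_extend (f f' : 'M[K]_m) (c : R) : 0 < c ->
  (forall u, ell f' u = c * ell f u) ->
  forall x, vnorm (f' *m x) = c * vnorm (f *m x).
Proof.
move=> c0 e.
pose P x y := rinner (f' *m x) (f' *m y) = c ^+ 2 * rinner (f *m x) (f *m y).
have PC x y : P x y -> P y x by rewrite /P rinnerC => ->; rewrite rinnerC.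
have PP x : (forall u : std_lattice, P x (val u)) -> forall y, P x y.
  move=> Px; apply: std_lattice_ind => //.
  - by rewrite /P !mulmx0 !rinner0r mulr0.
  - by move=> y z Py Pz; rewrite /P !mulmxDr !rinnerDr Py Pz mulrDr.
  - by move=> a y Py; rewrite /P !realK_scaler !rinnerZr Py mulrCA.
have Puu (u : std_lattice) : P (val u) (val u).
  by rewrite /P !rinnerxx -exprMn; congr (_ ^+ 2); exact: e.
have Puv (u v : std_lattice) : P (val u) (val v).
  have [_ OB _] := oset_subring O.
  have uvO : val u + val v \is a mxOver (oset O).
    apply/mxOverP => i j; rewrite mxE -[val v i j]opprK OB //.
      exact: (mxOverP (valP u)).
    rewrite -sub0r OB //; last exact: (mxOverP (valP v)).
    by rewrite -(subrr (val v i j)) OB //; exact: (mxOverP (valP v)).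
  have := Puu (exist (fun u => is_true (u \is a mxOver (oset O))) _ uvO).
  have := Puu u; have := Puu v; rewrite /P /= !mulmxDr !rinnerxDx.
  by lra.
have Pxx x : P x x by apply/PP => u; apply/PC; apply: PP => v.
move=> x; have := Pxx x; rewrite /P !rinnerxx -exprMn => /eqP.
by rewrite eqrXn2 // ?mulr_ge0 ?sqrtr_ge0 ?ltW // => /eqP.
Qed.

Lemma thurston_actE (g : SLtype R k n) f :
  thurston_act g (thurston_class f) = thurston_class (mulmx_adj f g).
Proof.
rewrite /thurston_act; case: pselect => [xf|[]]; last by exists f.
case: (cid xf) => f' /= /eqP/thurston_classP[c c0 e].
apply/eqP/thurston_classP; exists c^-1; first by rewrite invr_gt0.
move=> u; rewrite /ell /= -!mulmxA (ell_extend c0 e).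
by rewrite mulKf // gt_eqF.
Qed.

End Thurston.

Section Satake.
Variables (R : realType) (k : skewfield) (n : nat).
Local Notation K := (Kof R k).
Local Notation m := n.+1.
Local Open Scope quotient_scope.

(* The topology of 'M[K]_m as a finite dimensional real vector space is given by
   the real coordinates of the entries; when K is R or C the coordinates q1, q2,
   q3 or q2, q3 vanish. *)
Definition real_coordinates (h : 'M[K]_m) : 'M['rV[R]_4]_m :=
  \matrix_(i, j) \row_l
    tnth [tuple q0 (toH (h i j)); q1 (toH (h i j)); q2 (toH (h i j));
                q3 (toH (h i j))] l.

Definition matrix_space := initial_topology real_coordinates.
HB.instance Definition _ := Topological.copy matrix_space
  (initial_topology real_coordinates).

Definition nonzero_sym : set matrix_space :=
  [set h : 'M[K]_m | adjmx h = h /\ h != 0].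

Definition proportional (h h' : nonzero_sym) :=
  `[< exists2 c : R, c != 0 & (val h' : 'M[K]_m) = realK k c *: val h >].

Lemma proportional_refl : reflexive proportional.
Proof. by move=> h; apply/asboolP; exists 1; rewrite ?oner_eq0 // realK1 scale1r. Qed.
Lemma proportional_sym : symmetric proportional.
Proof.
suff H h h' : proportional h h' -> proportional h' h.
  by move=> h h'; apply/idP/idP; exact: H.
move=> /asboolP[c c0 e]; apply/asboolP; exists c^-1; first by rewrite invr_eq0.
by rewrite e scalerA -realKM mulVf // realK1 scale1r.
Qed.
Lemma proportional_trans : transitive proportional.
Proof.
move=> h' h h'' /asboolP[c c0 e] /asboolP[d d0 e']; apply/asboolP.
by exists (d * c); rewrite ?mulf_neq0 // e' e scalerA realKM.
Qed.
Canonical proportional_equiv :=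
  EquivRel proportional proportional_refl proportional_sym proportional_trans.

Definition satake_space := quotient_topology {eq_quot proportional_equiv}%qT.
HB.instance Definition _ := Topological.copy satake_space
  (quotient_topology {eq_quot proportional_equiv}%qT).

Lemma congr_nonzero_sym (g : SLtype R k n) (h : nonzero_sym) :
  nonzero_sym (val g *m (val h : 'M[K]_m) *m adjmx (val g)).
Proof.
have [hh h0] := set_mem (valP h); split.
  by rewrite !adjmxM adjmxK [adjmx (val h)]hh mulmxA.
have [g' _ [gg' g'g]] := SLV (valP g); apply: contra h0 => /eqP ghg0.
apply/eqP; rewrite -[LHS]mulmx1 -[LHS]mul1mx -[in X in _ *m X]adjmx1 -g'g adjmxM.
rewrite !mulmxA -[g' *m _ *m _]mulmxA -[g' *m _ *m _]mulmxA ghg0.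
by rewrite mulmx0 mul0mx.
Qed.

Definition congr_point (g : SLtype R k n) (h : nonzero_sym) : nonzero_sym :=
  SigSub (mem_set (congr_nonzero_sym g h)).

Lemma one_nonzero_sym : nonzero_sym (1%:M : 'M[K]_m).
Proof. by split; [exact: adjmx1|exact: mx1_neq0]. Qed.
Definition one_point : nonzero_sym := SigSub (mem_set one_nonzero_sym).

Definition satake_class (h : nonzero_sym) : satake_space :=
  \pi_(satake_space) h.

(* g.R h = R (g h g^* ), see satake_actE. *)
Definition satake_act (g : SLtype R k n) (x : satake_space) : satake_space :=
  satake_class (congr_point g (repr x)).

(* The class of g is sent to the line R (g g^* ), see satake_embE. *)
Definition satake_emb (x : symspace R k n) : satake_space :=
  satake_class (congr_point (repr x) one_point).

Lemma satake_actE (g : SLtype R k n) h :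
  satake_act g (satake_class h) = satake_class (congr_point g h).
Proof.
rewrite /satake_act /satake_class; case: piP => h' /eqmodP/asboolP[c c0 e].
apply/eqmodP/asboolP; exists c^-1; first by rewrite invr_eq0.
rewrite /= e realK_scaler -scalemxAl scalerA -realKM mulVf //.
by rewrite realK1 scale1r.
Qed.

Lemma satake_embE (g : SLtype R k n) :
  satake_emb (\pi_(symspace R k n) g) = satake_class (congr_point g one_point).
Proof.
rewrite /satake_emb; case: piP => h /eqmodP/asboolP[u /andP[/eqP uU _] hg].
congr satake_class; apply: val_inj; rewrite /= !mulmx1 hg adjmxM mulmxA.
by rewrite -[_ *m u *m _]mulmxA uU mulmx1.
Qed.

Definition satake_closure : set satake_space := closure (range satake_emb).

End Satake.

(* The two G-compactifications of X are given as subspaces C of T and D of U, with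
   the maps i : X -> C and j : X -> D and the actions of G. *)
Definition Gisomorphic (G X : Type) (T U : topologicalType)
    (C : set T) (i : X -> T) (actT : G -> T -> T)
    (D : set U) (j : X -> U) (actU : G -> U -> U) :=
  exists (F : T -> U) (F' : U -> T),
    [/\ set_fun C D F /\ set_fun D C F',
        {in C, cancel F F'} /\ {in D, cancel F' F},
        {within C, continuous F} /\ {within D, continuous F'},
        forall g x, C x -> F (actT g x) = actU g (F x)
      & forall x, F (i x) = j x].

Arguments thurston_space {R k} O n.
Arguments thurston_emb {R k} O n.
Arguments thurston_closure {R k} O n.
Arguments thurston_act {R k} O n.
Arguments satake_space R k n : clear implicits.
Arguments satake_emb R k n : clear implicits.
Arguments satake_closure R k n : clear implicits.
Arguments satake_act R k n : clear implicits.

(* Main.v *)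
Require Import Defs.
From mathcomp Require Import all_boot all_order all_algebra.
From mathcomp Require Import all_classical all_reals topology.
From mathcomp Require Import generic_quotient complex normedtype realfun.
From mathcomp Require Import ring lra.

(** The function l_f on the standard lattice and the Gram matrix f^* f carry the
    same information: by polarization, the function l_f' is c l_f if and only if
    f'^* f' = c^2 f^* f ([gram_similarity]). This needs only the values on the
    lattice because the lattice spans the whole space over the reals
    ([ell_extend]). Hence [l_f] |-> [f^* f] is a well defined bijection between
    the classes of nonzero matrices f on both sides ([thurston_satake_class]).
    It sends the marked lattice g^* to g g^* and turns f |-> f g^* into
    h |-> g h g^*, so it matches the embeddings and the actions.

    Continuity in both directions comes from compactness. Every nonzero f is a
    positive multiple of a matrix of Frobenius norm 1, which has the same
    classes ([rescale_to_sphere]), and these matrices form a compact space X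
    ([compact_sphere]). The maps a : f |-> [l_f] and b : f |-> [f^* f] are
    continuous on X, have the same fibres, and take values in Hausdorff spaces
    ([projcone_hausdorff], [satake_hausdorff]). Both images are therefore
    quotients of X by the same relation, hence homeomorphic. They are closed and
    contain the embedded symmetric space, so that they contain its closures, and
    the homeomorphism restricts to these ([Gisomorphic_correspondence]). In
    particular every point of the Thurston compactification is some [l_f], with
    f nonzero. *)
Set Implicit Arguments.
Unset Strict Implicit.
Unset Printing Implicit Defensive.

Import Order.TTheory GRing.Theory Num.Theory.
Import numFieldNormedType.Exports.

Local Open Scope classical_set_scope.
Local Open Scope ring_scope.

(** * Topological preliminaries *)

Lemma compact_set_type (T : topologicalType) (D : set T) :
  compact D -> compact [set: D].
Proof.
move=> cD F PF _.
have FD : F (@set_val _ D @^-1` D).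
  by apply: filterS (@filterT _ F _) => z _; exact: set_mem (valP z).
have [p [Dp clp]] := cD (@set_val _ D @ F) _ FD.
exists (SigSub (mem_set Dp)); split=> // A B FA [_ [[C oC <-] Cp] CB].
have [_ [[z Az <-] Cz]] : (val @` A `&` C) !=set0.
  apply: clp; last exact: open_nbhs_nbhs.
  have FA' : F (@set_val _ D @^-1` (val @` A)).
    by apply: filterS FA => z Az; exists z.
  exact: FA'.
by exists z; split => //; exact: CB.
Qed.

Lemma ptws_continuous (X : topologicalType) (I : Type) (T : topologicalType)
    (f : X -> {ptws I -> T}) :
  (forall i, continuous (fun x => f x i)) -> continuous f.
Proof.
move=> cf x; apply/cvg_sup => i.
move: x; apply/(@continuousP _ (initial_topology (@^~ i))) => A [B oB <-].
by have /continuousP := cf i; apply.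
Qed.

Lemma continuous_mxentry (T : topologicalType) p q (i : 'I_p) (j : 'I_q) :
  continuous (fun M : 'M[T]_(p, q) => M i j).
Proof.
move=> M A MA; exists (fun i' j' => if (i' == i) && (j' == j) then A else setT).
  move=> i' j'; case: ifP => [/andP[/eqP -> /eqP ->] //|_]; exact: filterT.
by move=> N /(_ i j); rewrite !eqxx.
Qed.

(** Homogeneous coordinates that are not proportional separate two classes: with
    f = A (B x + B y) - B (A x + A y), the sign of f is constant on the classes
    and f y = - f x <> 0. No division is involved, so neither coordinate has to
    be nonzero, and classes under scaling of either sign are covered by
    coordinates of even degree. *)
Lemma quotient_hausdorff (R : realType) (T : topologicalType)
    (e : equiv_rel T) :
  (forall x y, ~~ e x y -> exists A B : T -> R,
    [/\ continuous A, continuous B, A x * B y != A y * B x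
      & forall z w, e z w ->
          exists2 c, 0 < c & A w = c * A z /\ B w = c * B z]) ->
  hausdorff_space (quotient_topology {eq_quot e}%qT).
Proof.
move=> sep; rewrite open_hausdorff => p q.
elim/quotW: p => x; elim/quotW: q => y pq.
have xy : ~~ e x y by apply: contra pq => exy; apply/eqP/eqmodP.
have {sep xy}[A [B [cA cB AB hom]]] := sep _ _ xy.
pose f z := A z * (B x + B y) - B z * (A x + A y).
have cf : continuous f.
  move=> z; apply: cvgB; apply: cvgM; by [exact: cA|exact: cB|exact: cvg_cst].
have fhom z w : e z w -> exists2 c, 0 < c & f w = c * f z.
  move=> /hom[c c0 [Aw Bw]]; exists c => //; rewrite /f Aw Bw; ring.
have frepr z : exists2 c, 0 < c &
    f (repr (\pi_(quotient_topology {eq_quot e}%qT) z)%qT) = c * f z.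
  by apply/fhom/eqmodP; rewrite reprK.
have fy : f y = - f x by rewrite /f; ring.
have fx0 : f x != 0 by rewrite /f; apply: contra AB => /eqP ?; apply/eqP; lra.
(* The factor s = f x or - f x spares a case distinction on the sign of f x. *)
pose P (s : R) := [set r : quotient_topology {eq_quot e}%qT | 0 < s * f (repr r)].
have Pz s z :
    P s (\pi_(quotient_topology {eq_quot e}%qT) z)%qT = (0 < s * f z) :> Prop.
  by rewrite /P /=; have [c c0 ->] := frepr z; rewrite mulrCA pmulr_rgt0.
have Po s : open (P s).
  rewrite /open /= /quotient_open.
  rewrite (_ : _ @^-1` _ = (fun z => s * f z) @^-1` [set r | 0 < r]).
    apply: open_comp; last exact: open_gt.
    by move=> z _; apply: cvgM; [exact: cvg_cst|exact: cf].
  by apply/seteqP; split=> z; rewrite /preimage /= Pz.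
exists (P (f x), P (- f x)) => /=.
  by rewrite !inE !Pz fy mulrNN -expr2 exprn_even_gt0.
split; [exact: Po|exact: Po|apply/eqP/seteqP; split=> // r [] /=].
by rewrite /P /= mulNr; lra.
Qed.

(** * Compactifications corresponding through a compact space *)

Section CompactCorrespondence.

Lemma closed_image_preimage (X T U : topologicalType) (a : X -> T) (b : X -> U)
    (Z : set U) :
  compact [set: X] -> hausdorff_space T -> continuous a -> continuous b ->
  closed Z -> closed (a @` (b @^-1` Z)).
Proof.
move=> cX hT ca cb cZ; apply: compact_closed => //.
apply: continuous_compact; first exact: continuous_subspaceT.
apply: (subclosed_compact _ cX) => //.
by move/continuous_closedP: cb; exact.
Qed.

(** The map a is closed onto its image, because X is compact and T is Hausdorff;
    so b descends to a continuous map on that image. Applied to the whole of U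
    and to the closure of the range of j, the same closedness shows that the
    closure of the range of i lies in the image of a and is sent to the closure
    of the range of j. *)
Lemma closure_extension (Y : Type) (X T U : topologicalType)
    (a : X -> T) (b : X -> U) (i : Y -> T) (j : Y -> U) (x0 : X) :
  compact [set: X] -> hausdorff_space T -> continuous a -> continuous b ->
  (forall x x', a x = a x' -> b x = b x') ->
  (forall y, exists x, a x = i y /\ b x = j y) ->
  exists F : T -> U, [/\ forall x, F (a x) = b x,
    closure (range i) `<=` range a,
    set_fun (closure (range i)) (closure (range j)) F
    & {within closure (range i), continuous F}].
Proof.
move=> cX hT ca cb ab ij.
pose F t := if pselect (exists x, a x = t) is left e then b (projT1 (cid e))
            else b x0.
have Fa x : F (a x) = b x.
  by rewrite /F; case: pselect => [e|[]]; [case: cid => x' /= /ab|exists x].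
have icl (Z : set U) : range j `<=` Z -> closed Z ->
    closure (range i) `<=` a @` (b @^-1` Z).
  move=> jZ cZ; have /closure_id -> : closed (a @` (b @^-1` Z)).
    exact: closed_image_preimage.
  apply: closureS => _ [y _ <-]; have [x [<- bx]] := ij y.
  by exists x => //; rewrite /preimage /= bx; apply: jZ; exists y.
have ira : closure (range i) `<=` range a.
  by move=> t /(icl setT (@subsetT _ _) (@closedT _))[x _ <-]; exists x.
exists F; split => //.
  move=> t /(icl _ (@subset_closure _ _) (@closed_closure _ _))[x bx <-].
  by rewrite Fa.
apply: (continuous_subspaceW ira); apply/continuous_closedP => Z cZ.
apply/closed_subspaceP; exists (a @` (b @^-1` Z)).
  exact: closed_image_preimage.
apply/seteqP; split=> t /=.
  case=> -[x bx <-] _; split; last by exists x.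
  by rewrite -[from_subspace _ _ _]/(F (a x)) Fa.
case=> + [x _ xt]; rewrite -xt -[from_subspace _ _ _]/(F (a x)) Fa => bx.
by split; exists x.
Qed.

(** The pairs (a x, b x) form the graph of the isomorphism; the last two
    hypotheses say that the graph contains the pairs (i y, j y) and is stable
    under G. *)
Lemma Gisomorphic_correspondence (G Y : Type) (X T U : topologicalType)
    (a : X -> T) (b : X -> U) (i : Y -> T) (j : Y -> U)
    (actT : G -> T -> T) (actU : G -> U -> U) (x0 : X) :
  compact [set: X] -> hausdorff_space T -> hausdorff_space U ->
  continuous a -> continuous b ->
  (forall x x', a x = a x' <-> b x = b x') ->
  (forall y, exists x, a x = i y /\ b x = j y) ->
  (forall g x, exists x', a x' = actT g (a x) /\ b x' = actU g (b x)) ->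
  Gisomorphic (closure (range i)) i actT (closure (range j)) j actU.
Proof.
move=> cX hT hU ca cb ab ij act.
have [F [Fa ia FC Fc]] :=
  closure_extension x0 cX hT ca cb (fun x x' => (ab x x').1) ij.
have ji y : exists x, b x = j y /\ a x = i y.
  by have [x [? ?]] := ij y; exists x.
have [F' [Fb jb FC' Fc']] :=
  closure_extension x0 cX hU cb ca (fun x x' => (ab x x').2) ji.
exists F, F'; split => //.
- split=> t /set_mem; first by move=> /ia[x _ <-]; rewrite Fa Fb.
  by move=> /jb[x _ <-]; rewrite Fb Fa.
- move=> g _ /ia[x _ <-]; have [x' [<- bx']] := act g x.
  by rewrite !Fa bx'.
- by move=> y; have [x [<- <-]] := ij y.
Qed.

End CompactCorrespondence.

(** * Gram matrices *)

Section Gram.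
Variables (R : realType) (k : skewfield) (n : nat).
Local Notation K := (Kof R k).
Local Notation m := n.+1.

Definition gram (f : 'M[K]_m) : 'M[K]_m := adjmx f *m f.

Lemma mulmx_cV_eq0 (A : 'M[K]_m) : (forall x : 'cV[K]_m, A *m x = 0) -> A = 0.
Proof.
move=> A0; apply/matrixP => i j.
by have := A0 (delta_mx j 0); rewrite -colE => /matrixP/(_ i 0); rewrite !mxE.
Qed.

Lemma rinner_gram (f : 'M[K]_m) (x y : 'cV[K]_m) :
  rinner (f *m x) (f *m y) = rinner x (gram f *m y).
Proof. by rewrite /rinner !innerE adjmxM /gram !mulmxA. Qed.

Lemma rinner_eq0 (y : 'cV[K]_m) : (forall x : 'cV[K]_m, rinner x y = 0) -> y = 0.
Proof.
by move=> /(_ y); rewrite rinnerxx => /eqP; rewrite sqrf_eq0 vnorm_eq0 => /eqP.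
Qed.

(** Polarization: the norms of the f x determine the real inner products of f x
    and f y, and these determine f^* f since the real part of the inner product
    is nondegenerate. *)
Lemma gram_similarity (f f' : 'M[K]_m) (c : R) : 0 <= c ->
  (forall x : 'cV[K]_m, vnorm (f' *m x) = c * vnorm (f *m x)) <->
  gram f' = realK k (c ^+ 2) *: gram f.
Proof.
move=> c0; split=> [e|e x]; last first.
  apply/eqP; rewrite -(@eqrXn2 _ 2) ?mulr_ge0 ?sqrtr_ge0 // exprMn -!rinnerxx.
  by rewrite !rinner_gram e -scalemxAl rinnerZr.
have exx x : rinner (f' *m x) (f' *m x) = c ^+ 2 * rinner (f *m x) (f *m x).
  by rewrite !rinnerxx e exprMn.
have exy x y : rinner (f' *m x) (f' *m y) = c ^+ 2 * rinner (f *m x) (f *m y).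
  have := exx (x + y); rewrite !mulmxDr !rinnerxDx !exx; lra.
apply/subr0_eq/mulmx_cV_eq0 => y; apply/rinner_eq0 => x.
have rN z : rinner x (- z) = - rinner x z.
  by apply/eqP; rewrite -addr_eq0 -rinnerDr addNr rinner0r.
rewrite mulmxBl rinnerDr rN -scalemxAl rinnerZr -!rinner_gram exy; lra.
Qed.

Lemma gram_nonzero_sym (f : nonzero_mx R k n) :
  @nonzero_sym R k n (gram (val f)).
Proof.
split; first by rewrite /gram adjmxM adjmxK.
apply: contra (valP f) => /eqP g0; apply/eqP/mulmx_cV_eq0 => x.
apply/eqP; rewrite -vnorm_eq0 -(@sqrf_eq0 R) -rinnerxx rinner_gram g0 mul0mx.
by rewrite rinner0r.
Qed.

Definition gram_point (f : nonzero_mx R k n) : @nonzero_sym R k n :=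
  SigSub (mem_set (gram_nonzero_sym f)).

(** A positive ratio c of functions corresponds to the ratio c^2 of Gram
    matrices, and a ratio c of Gram matrices to the ratio sqrt c of functions. *)
Lemma thurston_satake_class (O : orderOf R k) (f f' : nonzero_mx R k n) :
  thurston_class O f = thurston_class O f' <->
  satake_class (gram_point f) = satake_class (gram_point f').
Proof.
split=> [/eqP/thurston_classP[c c0 e]|/eqmodP/asboolP[c c0 /= e]].
  apply/eqmodP/asboolP; exists (c ^+ 2); first by rewrite sqrf_eq0 gt_eqF.
  by apply/gram_similarity; [exact: ltW|exact: ell_extend e].
have ec x : vnorm (val f' *m x) ^+ 2 = c * vnorm (val f *m x) ^+ 2.
  by rewrite -!rinnerxx !rinner_gram e -scalemxAl rinnerZr.
(* Lines allow a negative ratio; f^* f and f'^* f' are positive and nonzero. *)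
have {}c0 : 0 < c.
  rewrite lt_neqAle eq_sym c0 /= leNgt; apply/negP => c0'.
  have /negP := valP f'; apply; apply/eqP/mulmx_cV_eq0 => x; apply/eqP.
  rewrite -vnorm_eq0 -(@sqrf_eq0 R) eq_le sqr_ge0 ec andbT.
  by rewrite mulr_le0_ge0 ?sqr_ge0 // ltW.
apply/eqP/thurston_classP; exists (Num.sqrt c); first by rewrite sqrtr_gt0.
move=> u; apply/eqP; rewrite -(@eqrXn2 _ 2) ?mulr_ge0 ?sqrtr_ge0 //.
by rewrite exprMn (sqr_sqrtr (ltW c0)); apply/eqP; exact: ec.
Qed.

Lemma thurston_class_scale (O : orderOf R k) (f f' : nonzero_mx R k n) c :
  0 < c -> val f' = realK k c *: val f ->
  thurston_class O f = thurston_class O f'.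
Proof.
move=> c0 e; apply/eqP/thurston_classP; exists c => //.
suff H x : vnorm (val f' *m x) = c * vnorm (val f *m x) by move=> u; exact: H.
move: x; apply/(gram_similarity _ _ (ltW c0)).
have cc : conjK (realK k c) = realK k c.
  apply: (@toH_inj R k); rewrite toH_conj toH_real.
  by apply: eq_quat => /=; ring.
rewrite /gram e realK_scaler expr2 realKM -scalerA [in RHS]scalemxAl.
congr (_ *: (_ *m _)); apply/matrixP => i j.
by rewrite !mxE conjKM cc realK_comm.
Qed.

End Gram.

(** * Continuity of matrix-valued functions *)

Ltac by_hypothesis := match goal with H : continuous _ |- _ => exact: H end.

Section QuaternionContinuity.
Variables (R : realType) (X : topologicalType).
Implicit Types f g : X -> quat R.

(** Continuity for the topology of R^4, expressed on components: the type of
    quaternions carries no topology. *)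
Definition qcontinuous f :=
  [/\ continuous (fun x => q0 (f x)), continuous (fun x => q1 (f x)),
      continuous (fun x => q2 (f x)) & continuous (fun x => q3 (f x))].

Lemma qcontinuous_cst (c : quat R) : qcontinuous (fun=> c).
Proof. by split=> x; apply: cvg_cst. Qed.

Lemma qcontinuousD f g :
  qcontinuous f -> qcontinuous g -> qcontinuous (fun x => f x + g x).
Proof.
by move=> [? ? ? ?] [? ? ? ?]; split=> x; rewrite /continuous_at /=;
  apply: cvgD; by_hypothesis.
Qed.

Lemma qcontinuousM f g :
  qcontinuous f -> qcontinuous g -> qcontinuous (fun x => f x * g x).
Proof.
move=> [? ? ? ?] [? ? ? ?]; split=> x /=; rewrite /continuous_at.
all: by repeat first [apply: cvgD | apply: cvgN | apply: cvgM]; by_hypothesis.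
Qed.

Lemma qcontinuous_conj f : qcontinuous f -> qcontinuous (fun x => conjq (f x)).
Proof.
by move=> [? ? ? ?]; split=> x; rewrite /continuous_at /=;
  try apply: cvgN; by_hypothesis.
Qed.

Lemma qcontinuous_sum I (r : seq I) (F : I -> X -> quat R) :
  (forall i, qcontinuous (F i)) -> qcontinuous (fun x => \sum_(i <- r) F i x).
Proof.
move=> cF; elim: r => [|i r IH].
  by under eq_fun do rewrite big_nil; exact: qcontinuous_cst.
by under eq_fun do rewrite big_cons; exact: qcontinuousD.
Qed.

Lemma continuous_normq2 f : qcontinuous f -> continuous (fun x => normq2 (f x)).
Proof.
move=> [? ? ? ?] x; rewrite /normq2.
by repeat apply: cvgD; under eq_fun do rewrite expr2; rewrite expr2;
  apply: cvgM; by_hypothesis.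
Qed.

Lemma continuous_sum I (r : seq I) (F : I -> X -> R) :
  (forall i, continuous (F i)) -> continuous (fun x => \sum_(i <- r) F i x).
Proof.
by move=> cF; apply: continuous_big => //; exact: add_continuous.
Qed.

End QuaternionContinuity.

Section MatrixContinuity.
Variables (R : realType) (k : skewfield) (X : topologicalType).
Local Notation K := (Kof R k).

(** For the three fields at once, entries are read as quaternions. *)
Definition mxcontinuous p q (F : X -> 'M[K]_(p, q)) :=
  forall i j, qcontinuous (fun x => toH (F x i j)).

Lemma mxcontinuous_cst p q (A : 'M[K]_(p, q)) : mxcontinuous (fun=> A).
Proof. by move=> i j; exact: qcontinuous_cst. Qed.

Lemma mxcontinuousM p q r (F : X -> 'M[K]_(p, q)) (G : X -> 'M[K]_(q, r)) :
  mxcontinuous F -> mxcontinuous G -> mxcontinuous (fun x => F x *m G x).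
Proof.
move=> cF cG i j.
rewrite (_ : (fun x => _) = fun x => \sum_l toH (F x i l) * toH (G x l j)).
  by apply: qcontinuous_sum => l; exact: qcontinuousM.
apply/funext => x; rewrite mxE (big_morph _ (@toHD R k) (toH0 R k)).
by apply: eq_bigr => l _; rewrite toHM.
Qed.

Lemma mxcontinuous_adj p q (F : X -> 'M[K]_(p, q)) :
  mxcontinuous F -> mxcontinuous (fun x => adjmx (F x)).
Proof.
move=> cF i j; under eq_fun do rewrite !mxE toH_conj.
exact: qcontinuous_conj.
Qed.

Lemma continuous_vnorm p (F : X -> 'cV[K]_p) :
  mxcontinuous F -> continuous (fun x => vnorm (F x)).
Proof.
move=> cF x; apply: (@continuous_comp _ _ _ (fun x => reK (inner (F x) (F x)))).
  move: x; rewrite (_ : (fun x => _) = fun x => \sum_i normq2 (toH (F x i 0))).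
    by apply: continuous_sum => i; exact: continuous_normq2.
  apply/funext => x; rewrite reK_sum; apply: eq_bigr => i _; exact: reK_conjM.
exact: sqrt_continuous.
Qed.

(** The square of the Frobenius norm. *)
Definition frob2 p q (A : 'M[K]_(p, q)) : R :=
  \sum_i \sum_j normq2 (toH (A i j)).

Lemma continuous_frob2 p q (F : X -> 'M[K]_(p, q)) :
  mxcontinuous F -> continuous (fun x => frob2 (F x)).
Proof.
move=> cF; apply: continuous_sum => i; apply: continuous_sum => j.
exact: continuous_normq2.
Qed.

Lemma continuous_matrix_space n (F : X -> 'M[K]_n.+1) :
  mxcontinuous F -> continuous (F : X -> matrix_space R k n).
Proof.
move=> cF; apply: continuous_comp_initial => x A [P PF sPA].
suff : \forall y \near x, forall i j, P i j (real_coordinates (F y) i j).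
  by apply: filterS => y Py; exact: sPA.
apply: filter_forall => i; apply: filter_forall => j.
have [Q QF sQP] := PF i j.
suff : \forall y \near x, forall a b, Q a b (real_coordinates (F y) i j a b).
  by apply: filterS => y Qy; exact: sQP.
apply: filter_forall => a; apply: filter_forall => b.
have cab : continuous (fun x => real_coordinates (F x) i j a b).
  have [c0 c1 c2 c3] := cF i j.
  under eq_fun do rewrite !mxE (tnth_nth 0) /=.
  by case: b {QF} => [[|[|[|[|b]]]] //= ltb]; by_hypothesis.
exact: cab (QF a b).
Qed.

End MatrixContinuity.

(** * Real coordinates and the Frobenius norm *)

Section Coordinates.
Variables (R : realType) (k : skewfield).
Local Notation K := (Kof R k).

Definition qcoord (l : 'I_4) (q : quat R) : R :=
  tnth [tuple q0 q; q1 q; q2 q; q3 q] l.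

Definition entry_coord p q (e : 'I_p * 'I_q * 'I_4) (A : 'M[K]_(p, q)) : R :=
  qcoord e.2 (toH (A e.1.1 e.1.2)).

Lemma entry_coord_inj p q (A B : 'M[K]_(p, q)) :
  (forall e, entry_coord e A = entry_coord e B) -> A = B.
Proof.
move=> AB; apply/matrixP => i j; apply: (@toH_inj R k).
have E l : qcoord l (toH (A i j)) = qcoord l (toH (B i j)) := AB (i, j, l).
by apply: eq_quat; [have := E 0|have := E 1|have := E 2|have := E 3];
  rewrite /qcoord !(tnth_nth 0).
Qed.

Lemma entry_coordZ p q e (c : R) (A : 'M[K]_(p, q)) :
  entry_coord e (realK k c *: A) = c * entry_coord e A.
Proof.
rewrite /entry_coord /qcoord mxE toHM toH_real !(tnth_nth 0).
by case: e => ij [[|[|[|[|l]]]] //= ltl]; ring.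
Qed.

Lemma entry_coord0 p q e : entry_coord e (0 : 'M[K]_(p, q)) = 0.
Proof.
rewrite /entry_coord /qcoord mxE toH0 (tnth_nth 0).
by case: e => ij [[|[|[|[|l]]]] //= ltl].
Qed.

Lemma frob2Z p q (c : R) (A : 'M[K]_(p, q)) :
  frob2 (realK k c *: A) = c ^+ 2 * frob2 A.
Proof.
rewrite /frob2 mulr_sumr; apply: eq_bigr => i _.
rewrite mulr_sumr; apply: eq_bigr => j _.
by rewrite mxE toHM toH_real /normq2 /=; ring.
Qed.

Lemma normq2_ge0 (q : quat R) : 0 <= normq2 q.
Proof. by rewrite /normq2 !addr_ge0 ?sqr_ge0. Qed.

Lemma frob2_ge0 p q (A : 'M[K]_(p, q)) : 0 <= frob2 A.
Proof. by do 2!apply: sumr_ge0 => ? _; exact: normq2_ge0. Qed.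

Lemma entry_coord_le_frob2 p q e (A : 'M[K]_(p, q)) : entry_coord e A ^+ 2 <= frob2 A.
Proof.
case: e => -[i j] l; rewrite /frob2 (bigD1 i) //= (bigD1 j) //= -addrA.
apply: (@le_trans _ _ (normq2 (toH (A i j)))).
  rewrite /entry_coord /qcoord /= (tnth_nth 0) /normq2.
  have sq := @sqr_ge0 R.
  case: l => [[|[|[|[|l]]]] //= ltl];
  by have := (sq (q0 (toH (A i j))), sq (q1 (toH (A i j))),
    sq (q2 (toH (A i j))), sq (q3 (toH (A i j)))); case=> -[[]]; lra.
rewrite lerDl addr_ge0 // sumr_ge0 // => *; first exact: normq2_ge0.
by apply: sumr_ge0 => *; exact: normq2_ge0.
Qed.

Lemma frob2_eq0 p q (A : 'M[K]_(p, q)) : (frob2 A == 0) = (A == 0).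
Proof.
apply/eqP/eqP => [A0|->].
  apply/entry_coord_inj => e; rewrite entry_coord0; apply/eqP.
  by rewrite -(@sqrf_eq0 R) eq_le sqr_ge0 andbT -A0 entry_coord_le_frob2.
rewrite /frob2 big1 // => i _; rewrite big1 // => j _.
by rewrite mxE toH0; apply/eqP; rewrite normq2_eq0.
Qed.

End Coordinates.

(** * Separation of the two projective spaces *)

Section Hausdorff.
Variables (R : realType).

(** The homogeneous coordinates are the evaluations at two points; if all of the
    2 x 2 minors vanish, the two functions are homothetic, with positive ratio
    because both are nonnegative and nonzero. *)
Lemma projcone_hausdorff (E : choiceType) : hausdorff_space (projcone R E).
Proof.
apply: (@quotient_hausdorff R) => l l' ll'.
have ev u : continuous (fun l : @cone R E => val l u).
  move=> x; apply: (@continuous_comp _ _ _ (@set_val _ (@cone R E)) (fun h => h u)).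
    exact: initial_continuous.
  exact: (@proj_continuous E (fun=> R)).
have [l0 [v lv]] := set_mem (valP l); have [l'0 [v' l'v]] := set_mem (valP l').
have [[u e]|] := pselect (exists u, val l u * val l' v != val l' u * val l v).
  exists (fun l => val l u), (fun l => val l v); split; try exact: ev.
    exact: e.
  by move=> z w /asboolP[c c0 ezw]; exists c; rewrite ?ezw.
move=> /forallNP e; case/negP: ll'; apply/asboolP.
have {}e u : val l' u = val l' v / val l v * val l u.
  by have /negP := e u; rewrite negbK => /eqP e'; field: e'.
exists (val l' v / val l v) => //; rewrite lt_neqAle divr_ge0 // andbT eq_sym.
by apply: contraNneq l'v => c0; rewrite e c0 mul0r.
Qed.

End Hausdorff.

Section SatakeHausdorff.
Variables (R : realType) (k : skewfield) (n : nat).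
Local Notation K := (Kof R k).
Local Notation m := n.+1.

Lemma continuous_entry_coord e :
  continuous (fun h : matrix_space R k n => entry_coord e (h : 'M[K]_m)).
Proof.
case: e => -[i j] l h.
rewrite (_ : (fun _ => _) =
    fun h : matrix_space R k n => real_coordinates h i j 0 l); last first.
  by apply/funext => h'; rewrite !mxE.
apply: (@continuous_comp _ _ _ _ (fun M : 'rV[R]_4 => M 0 l)).
  apply: (@continuous_comp _ _ _ _ (fun M : 'M['rV[R]_4]_m => M i j)).
    exact: initial_continuous.
  exact: continuous_mxentry.
exact: continuous_mxentry.
Qed.

Lemma mxcontinuous_matrix_space :
  mxcontinuous (fun h : matrix_space R k n => h : 'M[K]_m).
Proof.
move=> i j; have c (l : 'I_4) := @continuous_entry_coord (i, j, l).
by split; [have := c 0|have := c 1|have := c 2|have := c 3];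
  rewrite /entry_coord /qcoord; under eq_fun do rewrite (tnth_nth 0).
Qed.

(** The homogeneous coordinates are h_d h_e and |h|^2, all of degree 2, because
    points are lines: the ratio of two representatives may be negative. If
    h_d h_e / |h|^2 takes the same value at x and y for all d and e, fixing e
    with x_e <> 0 gives that y is proportional to x. *)
Lemma satake_hausdorff : hausdorff_space (satake_space R k n).
Proof.
apply: (@quotient_hausdorff R) => x y xy.
have cval : continuous (@set_val _ (@nonzero_sym R k n)).
  exact: initial_continuous.
have [_] := set_mem (valP x); rewrite -frob2_eq0 => x0.
have [_] := set_mem (valP y); rewrite -frob2_eq0 => y0.
pose A d e (z : @nonzero_sym R k n) :=
  entry_coord d (val z : 'M[K]_m) * entry_coord e (val z : 'M[K]_m).
pose B (z : @nonzero_sym R k n) := frob2 (val z : 'M[K]_m).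
have cc e : continuous
    (fun z : @nonzero_sym R k n => entry_coord e (val z : 'M[K]_m)).
  move=> z; apply: (@continuous_comp _ _ _ (@set_val _ (@nonzero_sym R k n))
    (fun h : matrix_space R k n => entry_coord e (h : 'M[K]_m))); first exact: cval.
  exact: continuous_entry_coord.
have [[d [e ne]]|] := pselect (exists d e, A d e x * B y != A d e y * B x).
  exists (A d e), B; split; last first.
  - move=> z w /asboolP[c c0 ezw]; exists (c ^+ 2).
      by rewrite exprn_even_gt0.
    by rewrite /A /B ezw !entry_coordZ frob2Z; split=> //; ring.
  - exact: ne.
  - move=> z; apply: (@continuous_comp _ _ _ (@set_val _ (@nonzero_sym R k n))
      (fun h : matrix_space R k n => frob2 (h : 'M[K]_m))); first exact: cval.
    exact: (continuous_frob2 mxcontinuous_matrix_space).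
  - by move=> z; exact: (cvgM (cc d z) (cc e z)).
move=> /forallNP ne; case/negP: xy; apply/asboolP.
have {}ne d e : A d e x * B y = A d e y * B x.
  by move/forallNP: (ne d) => /(_ e) /negP; rewrite negbK => /eqP.
have [e xe] : exists e, entry_coord e (val x : 'M[K]_m) != 0.
  apply: contrapT => /forallNP xe; case/negP: x0; rewrite frob2_eq0.
  apply/eqP/entry_coord_inj => e; rewrite entry_coord0; apply/eqP; apply: contraT => xe0.
  by case: (xe e).
have ye : entry_coord e (val y : 'M[K]_m) != 0.
  apply/eqP => ye; have /eqP := ne e e.
  by rewrite /A ye mulr0 mul0r !mulf_eq0 orbb (negbTE xe) (negbTE y0).
exists (entry_coord e (val x : 'M[K]_m) * B y /
        (entry_coord e (val y : 'M[K]_m) * B x)).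
  by rewrite !mulf_neq0 // invr_eq0 mulf_neq0.
apply/entry_coord_inj => d; rewrite entry_coordZ.
have := ne d e; rewrite /A => E; rewrite /B in E *.
move: (frob2 _) (frob2 _) (entry_coord _ _) (entry_coord _ _) (entry_coord _ _)
  (entry_coord _ _) E x0 y0 xe ye.
move=> x2 y2 ye yd xe xd E x20 y20 xe0 ye0.
apply: (@mulIf _ (ye * x2)); first by rewrite mulf_neq0.
rewrite mulrA -E; field; exact/andP.
Qed.

End SatakeHausdorff.

(** * The sphere of matrices *)

Section Sphere.
Variables (R : realType) (k : skewfield) (n : nat).
Local Notation K := (Kof R k).
Local Notation m := n.+1.
Local Notation E := ('I_m * 'I_m * 'I_4)%type.

(** The coordinates that K lacks are dropped, so that matrices are parametrized by
    4 m^2 real numbers in all three cases. *)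
Definition fromH : quat R -> K :=
  match k with
  | RealK => fun q => q0 q
  | ComplexK => fun q => Complex (q0 q) (q1 q)
  | QuaternionK => fun q => q
  end.

Lemma toHK : cancel (@toH R k) fromH.
Proof. by rewrite /fromH; case: k => // -[]. Qed.

Definition mx_of_coords (x : {ptws E -> R}) : 'M[K]_m :=
  \matrix_(i, j)
    fromH (Quat (x (i, j, 0)) (x (i, j, 1)) (x (i, j, 2)) (x (i, j, 3))).

Lemma mx_of_coordsK (f : 'M[K]_m) : mx_of_coords (fun e => entry_coord e f) = f.
Proof.
apply/matrixP => i j; rewrite mxE -[RHS]toHK; congr fromH.
by apply: eq_quat; rewrite /entry_coord /qcoord (tnth_nth 0).
Qed.

Lemma mxcontinuous_mx_of_coords : mxcontinuous mx_of_coords.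
Proof.
move=> i j.
have -> : (fun x : {ptws E -> R} => toH (mx_of_coords x i j)) = fun x =>
    toH (fromH (Quat (x (i, j, 0)) (x (i, j, 1)) (x (i, j, 2)) (x (i, j, 3)))).
  by apply/funext => x; rewrite mxE.
have cx e : continuous (fun x : {ptws E -> R} => x e).
  exact: (@proj_continuous E (fun=> R)).
have c0 : continuous (fun _ : {ptws E -> R} => 0 : R) by exact: cst_continuous.
rewrite /fromH /toH; case: k => /=.
- by split; [exact: (cx (i, j, 0))|exact: c0..].
- by split; [exact: (cx (i, j, 0))|exact: (cx (i, j, 1))|exact: c0..].
- by split; [exact: (cx (i, j, 0))|exact: (cx (i, j, 1))|exact: (cx (i, j, 2))
            |exact: (cx (i, j, 3))].
Qed.

(** For K real or complex the redundant coordinates do not enter the norm; the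
    bounds keep the set compact nonetheless, and are implied by the norm for the
    coordinates of an actual matrix. *)
Definition sphere : set {ptws E -> R} :=
  [set x | (forall e, [set` `[-1, 1]] (x e)) /\ frob2 (mx_of_coords x) = 1].

Lemma compact_sphere : compact sphere.
Proof.
apply: compact_closedI.
  apply: (@tychonoff _ (fun=> R) (fun=> [set` `[-1, 1]])) => e.
  exact: segment_compact.
change (closed ((fun x => frob2 (mx_of_coords x)) @^-1` [set (1 : R)])).
have /continuous_closedP := continuous_frob2 mxcontinuous_mx_of_coords; apply.
exact: closed_eq.
Qed.

Lemma mx_of_sphere (x : sphere) : mx_of_coords (val x) != 0.
Proof.
have [_ x1] := set_mem (valP x).
by rewrite -frob2_eq0 x1 oner_eq0.
Qed.

Definition sphere_mx (x : sphere) : nonzero_mx R k n :=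
  exist (fun f => is_true (f != 0)) _ (mx_of_sphere x).

Lemma mxcontinuous_sphere_mx : mxcontinuous (fun x : sphere => val (sphere_mx x)).
Proof.
have cval : continuous (@set_val _ sphere) by exact: initial_continuous.
move=> i j; have [c0 c1 c2 c3] := mxcontinuous_mx_of_coords i j.
by split=> x; [have := c0 (val x)|have := c1 (val x)|have := c2 (val x)|
  have := c3 (val x)] => c; exact: (continuous_comp (cval x) c).
Qed.

Lemma rescale_to_sphere (f : nonzero_mx R k n) :
  exists x : sphere,
    exists2 c : R, 0 < c & val (sphere_mx x) = realK k c *: val f.
Proof.
have f0 : 0 < frob2 (val f).
  by rewrite lt_neqAle eq_sym frob2_eq0 (valP f) frob2_ge0.
pose c := (Num.sqrt (frob2 (val f)))^-1.
have c0 : 0 < c by rewrite invr_gt0 sqrtr_gt0.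
pose g := realK k c *: val f.
have g1 : frob2 g = 1.
  by rewrite frob2Z exprVn sqr_sqrtr ?ltW // mulVf // gt_eqF.
have gs : sphere (fun e => entry_coord e g).
  split=> [e|]; last by rewrite mx_of_coordsK.
  rewrite /= in_itv /= -ler_norml -(@ler_pXn2r _ 2) ?nnegrE //.
  by rewrite expr1n -normrX ger0_norm ?sqr_ge0 // -g1 entry_coord_le_frob2.
by exists (SigSub (mem_set gs)), c; rewrite //= mx_of_coordsK.
Qed.

End Sphere.

(** * The isomorphism *)

Theorem mainTheorem2 (R : realType) (k : skewfield) (O : orderOf R k) (n : nat) :
  @Gisomorphic (SLtype R k n) (symspace R k n)
    (thurston_space O n) (satake_space R k n)
    (thurston_closure O n) (thurston_emb O n) (thurston_act O n)
    (satake_closure R k n) (satake_emb R k n) (satake_act R k n).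
Proof.
pose a (x : @sphere R k n) := thurston_class O (sphere_mx x).
pose b (x : @sphere R k n) := satake_class (gram_point (sphere_mx x)).
have ab f :
    exists x, a x = thurston_class O f /\ b x = satake_class (gram_point f).
  have [x [c c0 xf]] := rescale_to_sphere f; exists x.
  have e := esym (thurston_class_scale O c0 xf).
  by split=> //; apply/(thurston_satake_class O).
have [x0 _] := ab (nonzero_mx1 R k n).
apply: (@Gisomorphic_correspondence _ _ _ _ _ a b _ _ _ _ x0).
- exact/compact_set_type/compact_sphere.
- exact: projcone_hausdorff.
- exact: satake_hausdorff.
- move=> x; apply: continuous_comp; last exact: pi_continuous.
  move: x; apply: continuous_comp_initial; apply: ptws_continuous => u.
  apply: continuous_vnorm; apply: mxcontinuousM; last exact: mxcontinuous_cst.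
  exact: mxcontinuous_sphere_mx.
- move=> x; apply: continuous_comp; last exact: pi_continuous.
  move: x; apply: continuous_comp_initial; apply: continuous_matrix_space.
  apply: mxcontinuousM; last exact: mxcontinuous_sphere_mx.
  apply: mxcontinuous_adj; exact: mxcontinuous_sphere_mx.
- by move=> x x'; exact: thurston_satake_class.
- move=> y; have [x [ax bx]] := ab (mulmx_adj (nonzero_mx1 R k n) (repr y)).
  exists x; split; first exact: ax.
  rewrite bx; congr satake_class; apply: val_inj.
  by rewrite /= /gram !mul1mx adjmxK mulmx1.
- move=> g x; have [x' [ax bx]] := ab (mulmx_adj (sphere_mx x) g).
  exists x'; rewrite ax bx thurston_actE satake_actE; split=> //.
  congr satake_class; apply: val_inj.
  by rewrite /= /gram adjmxM adjmxK !mulmxA.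
Qed.
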